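(* Let $\tilde\alpha=\tilde\alpha(\bar s)$ be a unit speed regular dual curve on the dual unit sphere $\tilde S^2$ with dual Darboux frame $\{\tilde e,\tilde t,\tilde g\}$ and dual spherical curvature $\bar\gamma$, and let $\tilde\alpha_2=\frac{1}{\sqrt2}(\tilde e+\tilde g)$ be its dual Smarandache $\tilde e\tilde g$-curve, with dual spherical curvature $\bar\gamma_2$. Then $$\bar\gamma_2=\frac{1+\bar\gamma}{1-\bar\gamma}.$$
   Context: Dual numbers are $\bar a=a+\varepsilon a^*$ with $a,a^*\in\mathbb R$, $\varepsilon^2=0$; a differentiable real function is extended by $f(x+\varepsilon x^* )=f(x)+\varepsilon x^*f'(x)$. Dual vectors are $\tilde a=\vec a+\varepsilon\vec a^*$, $\vec a,\vec a^*\in\mathbb R^3$, with $\langle\tilde a,\tilde b\rangle=\langle\vec a,\vec b\rangle+\varepsilon(\langle\vec a,\vec b^*\rangle+\langle\vec a^*,\vec b\rangle)$, $\tilde a\times\tilde b=\vec a\times\vec b+\varepsilon(\vec a\times\vec b^*+\vec a^*\times\vec b)$, and norm $\|\tilde a\|=\|\vec a\|+\varepsilon\langle\vec a,\vec a^*\rangle/\|\vec a\|$ ($\vec a\ne0$). The dual unit sphere $\tilde S^2$ is the set of dual vectors with $\langle\tilde a,\tilde a\rangle=1+\varepsilon0$. Curves are smooth. For a regular dual curve on $\tilde S^2$ with position vector $\tilde e=\tilde\alpha$, $s$ denotes arc-length of the real part $\vec e$ (the real indicatrix), and the dual arc-length is $\bar s=\int\|d\tilde e/ds\|\,ds$; ''unit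 speed'' means that $\bar s$ is used as parameter, and $dF/d\bar s=(dF/ds)/(d\bar s/ds)$. The dual Darboux frame is $\tilde e$, $\tilde t=d\tilde e/d\bar s$, $\tilde g=\tilde e\times\tilde t$, and the dual spherical curvature $\bar\gamma$ is defined by $$\frac{d\tilde e}{d\bar s}=\tilde t,\quad \frac{d\tilde t}{d\bar s}=\bar\gamma\tilde g-\tilde e,\quad \frac{d\tilde g}{d\bar s}=-\bar\gamma\tilde t .$$ The quantities $\bar s_2,\tilde e_2=\tilde\alpha_2,\tilde t_2,\tilde g_2,\bar\gamma_2$ are the corresponding objects for $\tilde\alpha_2$ (a dual curve on $\tilde S^2$), where the dual arc-length parameter $\bar s_2$ is oriented so that $d\bar s_2/d\bar s=(1-\bar\gamma)/\sqrt2$; the curve $\tilde\alpha_2$ is considered where it is regular, i.e. where $1-\bar\gamma$ has nonzero real part. *)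

(* Defs.v *)
From HB Require Import structures.
From mathcomp Require Import all_boot all_order all_algebra.
From mathcomp Require Import mathcomp_extra boolp classical_sets functions.
From mathcomp Require Import reals topology normedtype derive.
From mathcomp Require Import ring.
Set Implicit Arguments.
Unset Strict Implicit.
Unset Printing Implicit Defensive.
Import Order.TTheory GRing.Theory Num.Theory.
Import numFieldNormedType.Exports.
Local Open Scope classical_set_scope.
Local Open Scope ring_scope.

(** [Dual a b] is a + eps b with eps^2 = 0: [dual R] is the ring of dual
    numbers over R, and [dual V] the [dual R]-module V + eps V (so that
    [dual 'rV[R]_3] is the module of dual vectors). *)
Record dual (V : Type) := Dual { re : V; du : V }.
Arguments re {V} _.
Arguments du {V} _.

Definition dual_pair V (x : dual V) := (re x, du x).
Definition pair_dual V (p : V * V) := Dual p.1 p.2.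
Lemma dual_pairK V : cancel (@dual_pair V) (@pair_dual V).
Proof. by case. Qed.

HB.instance Definition _ (V : eqType) :=
  Equality.copy (dual V) (can_type (@dual_pairK V)).
HB.instance Definition _ (V : choiceType) :=
  Choice.copy (dual V) (can_type (@dual_pairK V)).

Section DualZmodule.
Variable V : zmodType.
Implicit Types x y z : dual V.

Definition dual_zero : dual V := Dual 0 0.
Definition dual_opp x := Dual (- re x) (- du x).
Definition dual_add x y := Dual (re x + re y) (du x + du y).

Lemma dual_addA : associative dual_add.
Proof. by move=> x y z; rewrite /dual_add /= !addrA. Qed.
Lemma dual_addC : commutative dual_add.
Proof. by move=> x y; rewrite /dual_add addrC [du x + _]addrC. Qed.
Lemma dual_add0 : left_id dual_zero dual_add.
Proof. by case=> a b; rewrite /dual_add /= !add0r. Qed.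
Lemma dual_addN : left_inverse dual_zero dual_opp dual_add.
Proof. by case=> a b; rewrite /dual_add /= !addNr. Qed.

HB.instance Definition _ := GRing.isZmodule.Build (dual V)
  dual_addA dual_addC dual_add0 dual_addN.
End DualZmodule.

Section DualRing.
Variable R : comNzRingType.
Implicit Types x y z : dual R.

Definition dual_one : dual R := Dual 1 0.
Definition dual_mul x y := Dual (re x * re y) (re x * du y + du x * re y).

Lemma dual_mulA : associative dual_mul.
Proof. by move=> x y z; congr Dual => /=; ring. Qed.
Lemma dual_mulC : commutative dual_mul.
Proof. by move=> x y; congr Dual => /=; ring. Qed.
Lemma dual_mul1 : left_id dual_one dual_mul.
Proof. by case=> a b; congr Dual => /=; ring. Qed.
Lemma dual_mulDl : left_distributive dual_mul +%R.
Proof. by move=> x y z; congr Dual => /=; ring. Qed.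
Lemma dual_one_neq0 : dual_one != 0.
Proof. by apply/eqP => -[] /eqP; rewrite oner_eq0. Qed.

HB.instance Definition _ := GRing.Zmodule_isComNzRing.Build (dual R)
  dual_mulA dual_mulC dual_mul1 dual_mulDl dual_one_neq0.
End DualRing.

Section DualUnitRing.
Variable F : fieldType.
Implicit Types x y : dual F.

Definition dual_unit : {pred dual F} := fun x => re x != 0.

(* (a + eps b)^-1 = 1/a - eps b/a^2 when a != 0; non-units are fixed, which
   is the MathComp convention. *)
Definition dual_inv x :=
  if dual_unit x then Dual (re x)^-1 (- du x / re x ^+ 2) else x.

Lemma dual_mulV : {in dual_unit, left_inverse 1 dual_inv *%R}.
Proof.
move=> x; rewrite unfold_in => x0; rewrite /dual_inv /dual_unit x0.
by congr Dual => /=; field.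
Qed.

Lemma dual_unitP x y : y * x = 1 -> dual_unit x.
Proof.
move=> -[+ _]; rewrite /dual_unit => yx.
by apply: contra_eq_neq yx => ->; rewrite mulr0 eq_sym oner_neq0.
Qed.

Lemma dual_inv_out : {in [predC dual_unit], dual_inv =1 id}.
Proof. by move=> x; rewrite inE unfold_in /dual_inv /dual_unit => /negbTE ->. Qed.

HB.instance Definition _ := GRing.ComNzRing_hasMulInverse.Build (dual F)
  dual_mulV dual_unitP dual_inv_out.
End DualUnitRing.

Section DualLmodule.
Variables (R : comNzRingType) (V : lmodType R).
Implicit Types (k : dual R) (x y : dual V).

Definition dual_scale k x := Dual (re k *: re x) (re k *: du x + du k *: re x).

Lemma dual_scaleA k l x : dual_scale k (dual_scale l x) = dual_scale (k * l) x.
Proof.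
by congr Dual => /=; rewrite ?scalerDr ?scalerDl !scalerA ?addrA.
Qed.
Lemma dual_scale1 : left_id 1 dual_scale.
Proof.
by case=> a b; congr Dual => /=; rewrite ?scale0r ?scale1r ?addr0.
Qed.
Lemma dual_scaleDr : right_distributive dual_scale +%R.
Proof.
by move=> k x y; congr Dual => /=; rewrite !scalerDr // addrACA.
Qed.
Lemma dual_scaleDl x : {morph dual_scale^~ x : k l / k + l}.
Proof.
by move=> k l; congr Dual => /=; rewrite !scalerDl // addrACA.
Qed.

HB.instance Definition _ := GRing.Zmodule_isLmodule.Build (dual R) (dual V)
  dual_scaleA dual_scale1 dual_scaleDr dual_scaleDl.
End DualLmodule.

Section EuclideanSpace.
Variable R : realType.
Implicit Types u v : 'rV[R]_3.

Definition dot u v : R := \sum_i u 0 i * v 0 i.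

(* [`|u|] is the sup norm on ['rV[R]_3], hence the separate Euclidean norm. *)
Definition enorm u : R := Num.sqrt (dot u u).

(* Indices are in the ring ['I_3], i.e. taken modulo 3. *)
Definition cross u v : 'rV[R]_3 :=
  \row_k (u 0 (k + 1) * v 0 (k + 2) - u 0 (k + 2) * v 0 (k + 1)).
End EuclideanSpace.

Notation dvec R := (dual 'rV[R]_3).

Section DualVectors.
Variable R : realType.
Implicit Types a b : dvec R.

Definition real_dual (r : R) : dual R := Dual r 0.

Definition ddot a b : dual R :=
  Dual (dot (re a) (re b)) (dot (re a) (du b) + dot (du a) (re b)).

Definition dcross a b : dvec R :=
  Dual (cross (re a) (re b)) (cross (re a) (du b) + cross (du a) (re b)).

(* Meaningful only for [re a != 0]. *)
Definition dnorm a : dual R :=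
  Dual (enorm (re a)) (dot (re a) (du a) / enorm (re a)).

Definition dual_sphere : set (dvec R) := [set a | ddot a a = 1].
End DualVectors.

Section DualCalculus.
Variables (R : realType) (V : normedModType R).
Implicit Types (F : R -> dual V) (s : R) (J : set R).

Definition dderivable F s :=
  derivable (re \o F) s 1 /\ derivable (du \o F) s 1.

Definition dderiv F s : dual V :=
  Dual (derive1 (re \o F) s) (derive1 (du \o F) s).

Definition smooth_on J F := forall n s, J s ->
  derivable (derive1n n (re \o F)) s 1 /\
  derivable (derive1n n (du \o F)) s 1.
End DualCalculus.

(* dF/dsbar = (dF/ds) / (dsbar/ds). *)
Definition dderiv_wrt (R : realType) (V : normedModType R)
    (sbar : R -> dual R) (F : R -> dual V) (s : R) : dual V :=
  (dderiv sbar s)^-1 *: dderiv F s.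

Section DualCurves.
Variable R : realType.
Implicit Types (J : set R) (c : R -> dvec R) (sbar : R -> dual R).

Definition regular_dual_curve J c :=
  [/\ smooth_on J c,
      forall s, J s -> dual_sphere (c s) &
      forall s, J s -> re (dderiv c s) != 0].

(* The parameter is an arc-length of the real indicatrix. *)
Definition real_arclength J c := forall s, J s -> enorm (re (dderiv c s)) = 1.

(* [sbar] is an indefinite integral of ||dc/ds||.  This does not depend on
   the real parameter used for c, which therefore need not be the arc-length
   of re c. *)
Definition dual_arclength J c sbar := forall s, J s ->
  dderivable sbar s /\ dderiv sbar s = dnorm (dderiv c s).

(* The same up to the orientation of [sbar]. *)
Definition unoriented_dual_arclength J c sbar := forall s, J s ->
  dderivable sbar s /\
  (dderiv sbar s = dnorm (dderiv c s) \/ dderiv sbar s = - dnorm (dderiv c s)).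

Definition dual_tangent sbar c : R -> dvec R := dderiv_wrt sbar c.

Definition dual_normal sbar c : R -> dvec R :=
  fun s => dcross (c s) (dual_tangent sbar c s).

Definition dual_spherical_curvature J sbar c (gamma : R -> dual R) :=
  let t := dual_tangent sbar c in
  let g := dual_normal sbar c in
  forall s, J s ->
  [/\ dderiv_wrt sbar c s = t s,
      dderiv_wrt sbar t s = gamma s *: g s - c s &
      dderiv_wrt sbar g s = - (gamma s *: t s)].

Definition smarandache_eg sbar c : R -> dvec R :=
  fun s => real_dual (Num.sqrt 2)^-1 *: (c s + dual_normal sbar c s).
End DualCurves.

(* Main.v *)
(** Write [p] for d[sbar]/ds, [q] for d[sbar2]/ds and [k] for 1/sqrt 2.  The
    frame equations give d[e2]/ds = [k * p * (1 - gamma) *: t] = [q *: t], so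
    that the tangent of [e2] is [t] itself.  Hence the second frame equation of
    [e2] reads [p *: (gamma *: g - e) = q *: (gamma2 *: g2 - e2)] with
    [g2] = [k *: ((e + g) x t)], and its dot product with [g] is
    [p * gamma = q * k * (gamma2 - 1)], which is solved for [gamma2].

    The tangent of [e2] has to be known in a neighbourhood of [s], so the
    regular locus of [e2] must be open.  It is, since the real part of [gamma]
    is the triple product of the real parts of [e], [e'], [e'']: hence
    continuous, although nothing is assumed about the regularity of [gamma]. *)
Require Import Defs.
From mathcomp Require Import all_boot all_order all_algebra.
From mathcomp Require Import boolp classical_sets functions.
From mathcomp Require Import reals topology normedtype derive.
From mathcomp Require Import ring.
Set Implicit Arguments.
Unset Strict Implicit.
Unset Printing Implicit Defensive.
Import Order.TTheory GRing.Theory Num.Theory.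
Import numFieldNormedType.Exports.
Local Open Scope classical_set_scope.
Local Open Scope ring_scope.

Lemma dual_eq (V : Type) (x y : dual V) : re x = re y -> du x = du y -> x = y.
Proof. by case: x y => [a b] [c d] /= -> ->. Qed.

(** * Algebra of dual vectors, through their dual coordinates *)

Section DualVectorAlgebra.
Variable R : realType.
Implicit Types (a b c : dvec R) (k : dual R).

(** Coordinates in the commutative ring [dual R] turn the identities below, including their dual
    parts, into goals for [ring]. *)
Definition dcoord a (i : 'I_3) : dual R := Dual (re a 0 i) (du a 0 i).

Lemma ddotE a b : ddot a b =
  dcoord a 0 * dcoord b 0 + dcoord a 1 * dcoord b 1 + dcoord a 2 * dcoord b 2.
Proof.
rewrite /ddot /dot !big_ord_recl !big_ord0.
have -> : lift ord0 ord0 = 1 :> 'I_3 by apply/val_inj.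
have -> : lift ord0 (lift ord0 ord0) = 2 :> 'I_3 by apply/val_inj.
by apply: dual_eq => /=; ring.
Qed.

Lemma dcoordD a b i : dcoord (a + b) i = dcoord a i + dcoord b i.
Proof. by apply: dual_eq; rewrite /= mxE. Qed.

Lemma dcoordZ k a i : dcoord (k *: a) i = k * dcoord a i.
Proof. by apply: dual_eq; rewrite /= !mxE. Qed.

Lemma dcoord_cross a b i : dcoord (dcross a b) i =
  dcoord a (i + 1) * dcoord b (i + 2) - dcoord a (i + 2) * dcoord b (i + 1).
Proof. by apply: dual_eq; rewrite /= !mxE //; ring. Qed.

(** The product of equations serves as a multirule: one [rewrite] expands all three coordinates,
    with the indices modulo 3 already reduced. *)
Lemma dcoord_cross012 a b :
  (dcoord (dcross a b) 0 =
     dcoord a 1 * dcoord b 2 - dcoord a 2 * dcoord b 1) *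
  (dcoord (dcross a b) 1 =
     dcoord a 2 * dcoord b 0 - dcoord a 0 * dcoord b 2) *
  (dcoord (dcross a b) 2 =
     dcoord a 0 * dcoord b 1 - dcoord a 1 * dcoord b 0).
Proof.
rewrite !dcoord_cross.
have -> : 1 + 2 = 0 :> 'I_3 by apply/val_inj.
have -> : 2 + 1 = 0 :> 'I_3 by apply/val_inj.
have -> : 2 + 2 = 1 :> 'I_3 by apply/val_inj.
have -> : 1 + 1 = 2 :> 'I_3 by apply/val_inj.
by rewrite !add0r.
Qed.

Lemma ddotC a b : ddot a b = ddot b a.
Proof. by rewrite !ddotE; ring. Qed.

Lemma ddotDl a b c : ddot (a + b) c = ddot a c + ddot b c.
Proof. by rewrite !ddotE !dcoordD; ring. Qed.

Lemma ddotZl k a b : ddot (k *: a) b = k * ddot a b.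
Proof. by rewrite !ddotE !dcoordZ; ring. Qed.

Lemma ddotBl a b c : ddot (a - b) c = ddot a c - ddot b c.
Proof. by rewrite ddotDl -scaleN1r ddotZl mulN1r. Qed.

Lemma ddot_dcrossl a b : ddot a (dcross a b) = 0.
Proof. by rewrite !ddotE !dcoord_cross012; ring. Qed.

(** Lagrange's identity over the dual numbers. *)
Lemma ddot_dcross_self a b :
  ddot (dcross a b) (dcross a b) = ddot a a * ddot b b - ddot a b ^+ 2.
Proof. by rewrite !ddotE !dcoord_cross012; ring. Qed.

Lemma ddot_dcrossDZl k a b c d :
  ddot (dcross (k *: (a + b)) c) d =
    k * (ddot (dcross a c) d + ddot (dcross b c) d).
Proof. by rewrite !ddotE !dcoord_cross012 !dcoordZ !dcoordD; ring. Qed.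
End DualVectorAlgebra.

(** * Differentiation of dual vector functions *)

Section DualDerivation.
Variable R : realType.
Implicit Types s : R.

Lemma derive_rV n (u : R -> 'rV[R]_n) s i : derivable u s 1 ->
  u^`()%classic s 0 i = (fun x => u x 0 i)^`()%classic s.
Proof. by move=> u_s; rewrite !derive1E derive_mx // mxE. Qed.

(** A sum of products of functions is the form to which the sum and product rules for derivatives
    apply. *)
Lemma dotEfun (u v : R -> 'rV[R]_3) :
  (fun x => dot (u x) (v x)) = \sum_i ((fun x => u x 0 i) * (fun x => v x 0 i)).
Proof. by apply/funext => x; rewrite fct_sumE. Qed.

Lemma derivable_dot (u v : R -> 'rV[R]_3) s :
  derivable u s 1 -> derivable v s 1 ->
  derivable (fun x => dot (u x) (v x)) s 1.
Proof.
move=> /derivable_mxP cu /derivable_mxP cv.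
by rewrite dotEfun; apply: derivable_sum => i; apply: derivableM.
Qed.

Lemma derive_dot (u v : R -> 'rV[R]_3) s :
  derivable u s 1 -> derivable v s 1 ->
  (fun x => dot (u x) (v x))^`()%classic s =
    dot (u^`()%classic s) (v s) + dot (u s) (v^`()%classic s).
Proof.
move=> u_s v_s.
have [/derivable_mxP cu /derivable_mxP cv] := (u_s, v_s).
rewrite derive1E dotEfun derive_sum; last by move=> i; apply: derivableM.
rewrite -big_split; apply: eq_bigr => i _ /=.
rewrite (deriveM (cu 0 i) (cv 0 i)) (derive_rV _ u_s) (derive_rV _ v_s).
rewrite !derive1E addrC.
by congr (_ + _); apply: mulrC.
Qed.

Lemma derivable_cross (u v : R -> 'rV[R]_3) s :
  derivable u s 1 -> derivable v s 1 ->
  derivable (fun x => cross (u x) (v x)) s 1.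
Proof.
move=> /derivable_mxP cu /derivable_mxP cv; apply/derivable_mxP => i j.
under eq_fun do rewrite mxE.
exact: derivableB (derivableM (cu _ _) (cv _ _))
                  (derivableM (cu _ _) (cv _ _)).
Qed.

Lemma dderivableD (V : normedModType R) (F G : R -> dual V) s :
  dderivable F s -> dderivable G s -> dderivable (fun x => F x + G x) s.
Proof.
move=> [Fr Fd] [Gr Gd].
by split; [exact: (derivableD Fr Gr)|exact: (derivableD Fd Gd)].
Qed.

Lemma dderivD (V : normedModType R) (F G : R -> dual V) s :
  dderivable F s -> dderivable G s ->
  dderiv (fun x => F x + G x) s = dderiv F s + dderiv G s.
Proof.
move=> [Fr Fd] [Gr Gd]; rewrite /dderiv !derive1E.
by apply: dual_eq; apply: deriveD.
Qed.

Lemma dderivZ (V : normedModType R) (k : dual R) (F : R -> dual V) s :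
  dderivable F s -> dderiv (fun x => k *: F x) s = k *: dderiv F s.
Proof.
move=> [Fr Fd]; rewrite /dderiv !derive1E; apply: dual_eq; first exact: deriveZ.
rewrite [LHS](deriveD (derivableZ Fd) (derivableZ Fr)).
by rewrite !deriveZ.
Qed.

Lemma dderiv_near (V : normedModType R) (F G : R -> dual V) s :
  (\forall x \near s, F x = G x) -> dderiv F s = dderiv G s.
Proof.
move=> FG; rewrite /dderiv !derive1E.
by congr Dual; apply: near_eq_derive; apply: filterS FG => x /= ->.
Qed.

Lemma dderivable_near (V : normedModType R) (F G : R -> dual V) s :
  (\forall x \near s, F x = G x) -> dderivable F s -> dderivable G s.
Proof.
move=> FG [Fr Fd].
by split; [move: Fr|move: Fd]; apply: near_eq_derivable;
  apply: filterS FG => x /= ->.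
Qed.

Lemma dderiv_ddot (F G : R -> dvec R) s :
  dderivable F s -> dderivable G s ->
  dderiv (fun x => ddot (F x) (G x) : dual R^o) s =
    ddot (dderiv F s) (G s) + ddot (F s) (dderiv G s).
Proof.
move=> [Fr Fd] [Gr Gd]; apply: dual_eq; first exact: (derive_dot Fr Gr).
have Dd := deriveD (derivable_dot Fr Gd) (derivable_dot Fd Gr).
(* The derivative of the dual part has four terms; [addrACA] regroups them into the dual parts of
   the two products. *)
by rewrite -!derive1E !derive_dot // addrACA in Dd.
Qed.

Lemma dderivable_dcross (F G : R -> dvec R) s :
  dderivable F s -> dderivable G s ->
  dderivable (fun x => dcross (F x) (G x)) s.
Proof.
move=> [Fr Fd] [Gr Gd]; split; first exact: (derivable_cross Fr Gr).
exact: derivableD (derivable_cross Fr Gd) (derivable_cross Fd Gr).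
Qed.

Lemma scale_dderiv_wrt (V : normedModType R) (sbar : R -> dual R)
    (F : R -> dual V) s : dderiv sbar s \is a GRing.unit ->
  dderiv sbar s *: dderiv_wrt sbar F s = dderiv F s.
Proof. by move=> unit_p; rewrite scalerA divrr // scale1r. Qed.
End DualDerivation.

(** * Units and the dual norm *)

Lemma unit_dualE (F : fieldType) (x : dual F) :
  (x \is a GRing.unit) = (re x != 0).
Proof. by []. Qed.

Lemma ddot_dnorm (R : realType) (a : dvec R) :
  enorm (re a) != 0 -> ddot a a = dnorm a ^+ 2.
Proof.
move=> a0; have dot_ge0 : 0 <= dot (re a) (re a).
  by apply: sumr_ge0 => i _; rewrite -expr2 sqr_ge0.
rewrite expr2; apply: dual_eq => /=; first by rewrite -expr2 sqr_sqrtr.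
(* In the dual part of the square the norm cancels its own inverse, which is where it has to be
   nonzero. *)
rewrite mulrC divfK //; congr (_ + _).
by apply: eq_bigr => i _; rewrite mulrC.
Qed.

(** * The Darboux frame: differentiability, orthonormality and curvature *)

Section DualFrame.
Variables (R : realType) (I : set R) (e : R -> dvec R) (sbar : R -> dual R).
Hypotheses (I_open : open I) (e_reg : regular_dual_curve I e).
Hypotheses (e_arclength : real_arclength I e) (sbarP : dual_arclength I e sbar).
Let t := dual_tangent sbar e.
Let g := dual_normal sbar e.

Let near_I s : I s -> \forall x \near s, I x.
Proof. by move=> Is; apply: open_nbhs_nbhs; split. Qed.

Lemma re_dderiv_arclength s : I s -> re (dderiv sbar s) = 1.
Proof. by move=> Is; rewrite (sbarP Is).2 /= e_arclength. Qed.

Lemma unit_dderiv_arclength s : I s -> dderiv sbar s \is a GRing.unit.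
Proof. by move=> Is; rewrite unit_dualE re_dderiv_arclength ?oner_neq0. Qed.

Lemma dderivE s : I s -> dderiv e s = dderiv sbar s *: t s.
Proof. by move=> Is; rewrite scale_dderiv_wrt // unit_dderiv_arclength. Qed.

(** The dual speed is 1 + eps x with x the dot product of [re d] and [du d], so its inverse is 1 -
    eps x. The resulting formula has no division and shows that [t] is derivable. *)
Lemma dual_tangentE s : I s ->
  t s = let d := dderiv e s in
        Dual (re d) (du d - dot (re d) (du d) *: re d).
Proof.
move=> Is; rewrite /t /dual_tangent /dderiv_wrt (sbarP Is).2.
rewrite /GRing.inv /= /dual_inv /dual_unit /= e_arclength // oner_neq0.
by apply: dual_eq; rewrite /= !(divr1, invr1, expr1n, mulr1) scale1r // scaleNr.
Qed.

Lemma dderivable_curve s : I s -> dderivable e s.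
Proof. by case: e_reg => sm _ _ Is; exact: (sm 0%N s Is). Qed.

Lemma dderivable_dderiv s : I s -> dderivable (dderiv e) s.
Proof. by case: e_reg => sm _ _ Is; exact: (sm 1%N s Is). Qed.

Lemma dderivable_tangent s : I s -> dderivable t s.
Proof.
move=> Is; have [d_re d_du] := dderivable_dderiv Is.
apply: (@dderivable_near _ _ (fun s => let d := dderiv e s in
    Dual (re d) (du d - dot (re d) (du d) *: re d))).
  by apply: filterS (near_I Is) => x /dual_tangentE.
split; first exact: d_re.
apply/derivable_mxP => i j.
under eq_fun do rewrite !mxE.
have /derivable_mxP c_re := d_re; have /derivable_mxP c_du := d_du.
exact: derivableB (c_du i j) (derivableM (derivable_dot d_re d_du) (c_re i j)).
Qed.

Lemma dderivable_normal s : I s -> dderivable g s.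
Proof.
by move=> Is; apply: dderivable_dcross;
  [exact: dderivable_curve|exact: dderivable_tangent].
Qed.

Lemma ddot_curve s : I s -> ddot (e s) (e s) = 1.
Proof. by case: e_reg => _ + _; apply. Qed.

(** With p the dual speed, both p^2 times the square of [t] and p^2 itself equal the square of the
    derivative of [e]; the unit p^2 cancels. *)
Lemma ddot_tangent s : I s -> ddot (t s) (t s) = 1.
Proof.
move=> Is; have := ddot_dnorm (a := dderiv e s).
rewrite e_arclength // oner_neq0 -(sbarP Is).2 => /(_ isT).
rewrite {1 2}dderivE // ddotZl ddotC ddotZl mulrA -expr2 -[RHS]mulr1.
by move/mulrI; apply; rewrite unitrX // unit_dderiv_arclength.
Qed.

Lemma ddot_curve_tangent s : I s -> ddot (e s) (t s) = 0.
Proof.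
move=> Is; suff : ddot (e s) (dderiv e s) = 0.
  rewrite dderivE // ddotC ddotZl ddotC -[RHS](mulr0 (dderiv sbar s)).
  by move/mulrI; apply; apply: unit_dderiv_arclength.
(* Differentiating the constant square of [e] gives twice the wanted product. *)
have := dderiv_ddot (dderivable_curve Is) (dderivable_curve Is).
have -> : dderiv (fun x => ddot (e x) (e x) : dual R^o) s = 0.
  rewrite (@dderiv_near _ _ _ (fun=> Dual (1 : R^o) 0)); last first.
    by apply: filterS (near_I Is) => x; apply: ddot_curve.
  by apply: dual_eq; apply: derive1_cst.
rewrite [X in X + _]ddotC -mulr2n => /esym h.
(* The factor 2 is cancelled in R, on each part separately, since the dual numbers have zero
   divisors. *)
by apply: dual_eq; [move/(congr1 (@re R)): h|move/(congr1 (@du R)): h];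
  rewrite mulr2n /= -mulr2n => /eqP; rewrite mulrn_eq0 /= => /eqP.
Qed.

Lemma ddot_normal s : I s -> ddot (g s) (g s) = 1.
Proof.
move=> Is; rewrite ddot_dcross_self ddot_curve // ddot_tangent //.
by rewrite ddot_curve_tangent // mulr1 expr0n subr0.
Qed.

Variable gamma : R -> dual R.
Hypothesis gammaP : dual_spherical_curvature I sbar e gamma.

(** This is the second frame equation dotted with the unit vector [g], which is orthogonal to [e] as
    a cross product. *)
Lemma curvatureE s : I s -> gamma s = ddot (dderiv_wrt sbar t s) (g s).
Proof.
move=> Is; have [_ -> _] := gammaP Is.
by rewrite ddotBl ddotZl ddot_normal // ddot_dcrossl mulr1 subr0.
Qed.

(** The dual speed has real part 1, so on real parts [dderiv_wrt sbar] is plain differentiation in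
    [s], and [t] is the derivative of [e]. *)
Lemma re_curvatureE s : I s ->
  re (gamma s) = dot (derive1n 2 (re \o e) s)
                     (cross (re (e s)) (derive1n 1 (re \o e) s)).
Proof.
move=> Is; rewrite curvatureE // /dderiv_wrt ddotZl.
have : re (dderiv sbar s)^-1 * re (dderiv sbar s) = 1.
  exact: (congr1 re (mulVr (unit_dderiv_arclength Is))).
rewrite re_dderiv_arclength // mulr1 => inv_speed.
rewrite -[LHS]/(re (dderiv sbar s)^-1 *
  dot (re (dderiv t s)) (cross (re (e s)) (re (t s)))) inv_speed mul1r.
have -> : re (t s) = derive1n 1 (re \o e) s by rewrite (dual_tangentE Is).
suff -> : re (dderiv t s) = derive1n 2 (re \o e) s by [].
rewrite /dderiv /= !derive1E; apply: near_eq_derive.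
by apply: filterS (near_I Is) => x Ix; rewrite -[LHS]/(re (t x)) dual_tangentE.
Qed.

Lemma near_curvature_neq1 s : I s -> re (1 - gamma s) != 0 ->
  \forall x \near s, I x /\ re (1 - gamma x) != 0.
Proof.
move=> Is ns; apply: filterI (near_I Is) _ => /=.
case: e_reg => sm _ _.
have c : {for s, continuous (fun x => 1 - dot (derive1n 2 (re \o e) x)
    (cross (re (e x)) (derive1n 1 (re \o e) x)))}.
  apply/differentiable_continuous/derivable1_diffP.
  apply: derivableB; first exact: derivable_cst.
  apply: derivable_dot; first exact: (sm 2%N s Is).1.
  by apply: derivable_cross; [exact: (sm 0%N s Is).1|exact: (sm 1%N s Is).1].
(* A continuous function that is nonzero at [s] stays nonzero nearby; there it is compared with
   [gamma] at points of [I] only. *)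
move: ns; rewrite /= re_curvatureE // => /(cvgr_neq0 _ c).
by apply: filterS2 (near_I Is) => x Ix; rewrite re_curvatureE.
Qed.
End DualFrame.

(** * Curvature of the Smarandache curve *)

Theorem theorem5p9 (R : realType) (I : set R)
    (I_open : open I) (I_itv : is_interval I)
    (e : R -> dvec R) (e_reg : regular_dual_curve I e)
    (e_arclength : real_arclength I e)
    (sbar : R -> dual R) (sbarP : dual_arclength I e sbar)
    (gamma : R -> dual R)
    (gammaP : dual_spherical_curvature I sbar e gamma)
    (sbar2 gamma2 : R -> dual R) :
  let e2 := smarandache_eg sbar e in
  let J := [set s | I s /\ re (1 - gamma s) != 0] in
  unoriented_dual_arclength J e2 sbar2 ->
  (forall s, J s ->
     dderiv_wrt sbar sbar2 s = (1 - gamma s) / real_dual (Num.sqrt 2)) ->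
  dual_spherical_curvature J sbar2 e2 gamma2 ->
  forall s, J s -> gamma2 s = (1 + gamma s) / (1 - gamma s).
Proof.
move=> e2 J _ sbar2P gamma2P s Js; have [Is ns] := Js.
set k : dual R := real_dual (Num.sqrt 2)^-1.
set t := dual_tangent sbar e; set g := dual_normal sbar e.
have kE : (real_dual (Num.sqrt 2) : dual R)^-1 = k.
  rewrite /GRing.inv /= /dual_inv /dual_unit /= sqrtr_eq0 -ltNge ltr0n /=.
  by apply: dual_eq; rewrite //= oppr0 mul0r.
have k2 : k * k + k * k = 1.
  apply: dual_eq; rewrite /= ?(mul0r, mulr0, addr0) //.
  by rewrite -expr2 exprVn sqr_sqrtr ?ler0n // -[_^-1]div1r -splitr.
have unit_k : k \is a GRing.unit.
  by rewrite unit_dualE /= invr_eq0 sqrtr_eq0 -ltNge ltr0n.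
have dsbar2 x : J x -> dderiv sbar2 x = dderiv sbar x * ((1 - gamma x) * k).
  move=> Jx; rewrite -kE -sbar2P //.
  (* On dual numbers the scaling inside [dderiv_wrt] is, by conversion, the dual product. *)
  rewrite -[RHS]/(dderiv sbar x * ((dderiv sbar x)^-1 * dderiv sbar2 x)).
  by rewrite mulVKr //; apply: (unit_dderiv_arclength e_arclength sbarP Jx.1).
have unit_q x : J x -> dderiv sbar2 x \is a GRing.unit.
  move=> [Ix nx]; rewrite dsbar2 // !unitrM unit_k [X in _ && (X && _)]nx !andbT.
  exact: (unit_dderiv_arclength e_arclength sbarP Ix).
have t2E x : J x -> dual_tangent sbar2 e2 x = t x.
  move=> Jx; have [Ix _] := Jx.
  have unit_p := unit_dderiv_arclength e_arclength sbarP Ix.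
  have de : dderiv e x = dderiv sbar x *: t x.
    exact: (dderivE e_arclength sbarP).
  have dg : dderiv g x = dderiv sbar x *: - (gamma x *: t x).
    have [_ _ <-] := gammaP x Ix.
    by rewrite scale_dderiv_wrt.
  have deI := dderivable_curve e_reg Ix.
  have dgI := dderivable_normal I_open e_reg e_arclength sbarP Ix.
  (* Expanding 1 as q^-1 * q in front of [t] leaves the claim that the derivative of [e2] is
     [q *: t]. *)
  rewrite /dual_tangent /dderiv_wrt -[RHS]scale1r -(mulVr (unit_q _ Jx)).
  rewrite -scalerA; congr (_ *: _).
  have -> : dderiv e2 x = k *: (dderiv e x + dderiv g x).
    by rewrite -(dderivD deI dgI) -(dderivZ k (dderivableD deI dgI)).
  rewrite de dg dsbar2 // -scalerDr -[X in X - _]scale1r -scalerBl !scalerA.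
  by congr (_ *: _); ring.
have dt2E : dderiv (dual_tangent sbar2 e2) s = dderiv t s.
  apply: dderiv_near.
  apply: filterS (near_curvature_neq1 I_open e_reg e_arclength sbarP gammaP Is ns).
  exact: t2E.
have unit_p := unit_dderiv_arclength e_arclength sbarP Is.
have dt : dderiv t s = dderiv sbar s *: (gamma s *: g s - e s).
  have [_ <- _] := gammaP s Is.
  exact: esym (scale_dderiv_wrt t unit_p).
have gg : ddot (g s) (g s) = 1.
  exact: (ddot_normal I_open e_reg e_arclength sbarP Is).
have eg : ddot (e s) (g s) = 0 by apply: ddot_dcrossl.
have e2g : ddot (e2 s) (g s) = k.
  by rewrite /e2 ddotZl ddotDl eg gg add0r mulr1.
have g2g : ddot (dual_normal sbar2 e2 s) (g s) = k.
  have -> : dual_normal sbar2 e2 s = dcross (k *: (e s + g s)) (t s).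
    by rewrite -(t2E s Js).
  (* The term with g x t is orthogonal to [g], and e x t is [g] itself. *)
  rewrite ddot_dcrossDZl [ddot (dcross (g s) _) _]ddotC ddot_dcrossl addr0.
  by rewrite [X in k * X]gg mulr1.
have frame2 : dderiv sbar s *: (gamma s *: g s - e s) =
    dderiv sbar2 s *: (gamma2 s *: dual_normal sbar2 e2 s - e2 s).
  have [_ eq2 _] := gamma2P s Js.
  rewrite -[RHS](congr1 (fun v => dderiv sbar2 s *: v) eq2).
  by rewrite (scale_dderiv_wrt _ (unit_q s Js)) dt2E dt.
have := congr1 (fun v => ddot v (g s)) frame2.
rewrite ddotZl ddotBl ddotZl gg eg ddotZl ddotBl ddotZl g2g e2g (dsbar2 s Js).
rewrite -mulrA mulr1 subr0 => /(mulrI unit_p) h.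
(* Here [ns] says, up to conversion, that [1 - gamma s] is a unit. *)
suff <- : gamma2 s * (1 - gamma s) = 1 + gamma s by rewrite mulrK.
(* Adding [h] to itself produces [k * k + k * k], which is 1, and so removes the square root of
   2. *)
have h2 : gamma s + gamma s = (1 - gamma s) * (gamma2 s - 1).
  by rewrite -[RHS]mulr1 -[X in _ = _ * X]k2 {1 2}h; ring.
transitivity ((1 - gamma s) * (gamma2 s - 1) + (1 - gamma s)); first by ring.
by rewrite -h2; ring.
Qed.
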